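(* Let $\mathcal F$ be an arbitrary division ring and let $A\in\mathcal F^{m\times p}$, $B\in\mathcal F^{m\times q}$, $C\in\mathcal F^{s\times p}$, $D\in\mathcal F^{t\times p}$, $E\in\mathcal F^{p_1\times m_1}$, $F\in\mathcal F^{p_1\times s_1}$, $G\in\mathcal F^{p_1\times t_1}$, $H\in\mathcal F^{q_1\times m_1}$, $\Phi\in\mathcal F^{m\times m_1}$, $\Psi\in\mathcal F^{s\times s_1}$, $\Omega\in\mathcal F^{t\times t_1}$ be given. The system of matrix equations $$AXE+BYH=\Phi,\qquad CXF=\Psi,\qquad DXG=\Omega$$ has a solution $(X,Y)\in\mathcal F^{p\times p_1}\times\mathcal F^{q\times q_1}$ if and only if all of the following rank equalities hold: $$\mathrm{r}\begin{pmatrix}\Phi&A\\ H&0\end{pmatrix}=\mathrm{r}(A)+\mathrm{r}(H),\quad \mathrm{r}\begin{pmatrix}\Phi&B\\ E&0\end{pmatrix}=\mathrm{r}(B)+\mathrm{r}(E),$$ $$\mathrm{r}(A,B,\Phi)=\mathrm{r}(A,B),\quad \mathrm{r}\begin{pmatrix}E\\ H\\ \Phi\end{pmatrix}=\mathrm{r}\begin{pmatrix}E\\ H\end{pmatrix},$$ $$\mathrm{r}(C,\Psi)=\mathrm{r}(C),\quad \mathrm{r}(D,\Omega)=\mathrm{r}(D),\quad \mathrm{r}\begin{pmatrix}F\\ \Psi\end{pmatrix}=\mathrm{r}(F),\quad \mathrm{r}\begin{pmatrix}G\\ \Omega\end{pmatrix}=\mathrm{r}(G),$$ $$\mathrm{r}\begin{pmatrix}\Psi&0&C\\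 0&-\Omega&D\\ F&G&0\end{pmatrix}=\mathrm{r}\begin{pmatrix}C\\ D\end{pmatrix}+\mathrm{r}(F,G),$$ $$\mathrm{r}\begin{pmatrix}0&0&E&F\\ A&B&-\Phi&0\\ C&0&0&\Psi\end{pmatrix}=\mathrm{r}\begin{pmatrix}A&B\\ C&0\end{pmatrix}+\mathrm{r}(E,F),\quad \mathrm{r}\begin{pmatrix}0&E&F\\ 0&H&0\\ A&-\Phi&0\\ C&0&\Psi\end{pmatrix}=\mathrm{r}\begin{pmatrix}E&F\\ H&0\end{pmatrix}+\mathrm{r}\begin{pmatrix}A\\ C\end{pmatrix},$$ $$\mathrm{r}\begin{pmatrix}0&0&E&G\\ A&B&-\Phi&0\\ D&0&0&\Omega\end{pmatrix}=\mathrm{r}\begin{pmatrix}A&B\\ D&0\end{pmatrix}+\mathrm{r}(E,G),\quad \mathrm{r}\begin{pmatrix}0&E&G\\ 0&H&0\\ A&-\Phi&0\\ D&0&\Omega\end{pmatrix}=\mathrm{r}\begin{pmatrix}E&G\\ H&0\end{pmatrix}+\mathrm{r}\begin{pmatrix}A\\ D\end{pmatrix},$$ $$\mathrm{r}\begin{pmatrix}0&0&E&F&G\\ 0&0&H&0&0\\ A&A&-\Phi&0&0\\ C&0&0&\Psi&0\\ 0&D&0&0&\Omega\end{pmatrix}=\mathrm{r}\begin{pmatrix}E&F&G\\ H&0&0\end{pmatrix}+\mathrm{r}\begin{pmatrix}A&A\\ C&0\\ 0&D\end{pmatrix},$$ $$\mathrm{r}\begin{pmatrix}0&0&E&F&0\\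 0&0&E&0&G\\ A&B&-\Phi&0&0\\ C&0&0&\Psi&0\\ D&0&0&0&\Omega\end{pmatrix}=\mathrm{r}\begin{pmatrix}A&B\\ C&0\\ D&0\end{pmatrix}+\mathrm{r}\begin{pmatrix}E&F&0\\ E&0&G\end{pmatrix},$$ $$\mathrm{r}\begin{pmatrix}0&0&0&E&F&G\\ A&A&B&-\Phi&0&0\\ C&0&0&0&\Psi&0\\ 0&D&0&0&0&\Omega\end{pmatrix}=\mathrm{r}(E,F,G)+\mathrm{r}\begin{pmatrix}A&A&B\\ C&0&0\\ 0&D&0\end{pmatrix},$$ $$\mathrm{r}\begin{pmatrix}0&E&F&0\\ 0&E&0&G\\ 0&H&0&0\\ A&-\Phi&0&0\\ C&0&\Psi&0\\ D&0&0&\Omega\end{pmatrix}=\mathrm{r}\begin{pmatrix}A\\ C\\ D\end{pmatrix}+\mathrm{r}\begin{pmatrix}E&F&0\\ E&0&G\\ H&0&0\end{pmatrix},$$ $$\mathrm{r}\begin{pmatrix}0&0&0&0&0&0&H\\ 0&0&0&G&0&E&0\\ 0&0&0&0&F&E&E\\ 0&C&0&0&-\Psi&0&0\\ 0&0&D&\Omega&0&0&0\\ 0&A&A&0&0&0&\Phi\\ B&0&A&0&0&-\Phi&0\end{pmatrix}=\mathrm{r}\begin{pmatrix}0&A&B\\ A&A&0\\ C&0&0\\ 0&D&0\end{pmatrix}+\mathrm{r}\begin{pmatrix}0&E&F&0\\ E&E&0&G\\ H&0&0&0\end{pmatrix}.$$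
   Context: $\mathcal F^{m\times n}$ is the set of $m\times n$ matrices over the division ring $\mathcal F$. The rank $\mathrm{r}(\cdot)$ of a matrix over $\mathcal F$ is the dimension of its left row space, equal to the dimension of its right column space. Blocks $0$ denote zero blocks of the appropriate size. *)

(* Defs.v *)
From mathcomp Require Import all_boot all_algebra.
From mathcomp Require Import boolp classical_sets.

Set Implicit Arguments.
Unset Strict Implicit.
Unset Printing Implicit Defensive.

Local Open Scope ring_scope.
Local Open Scope classical_set_scope.

(* MathComp's \rank, \dim and vspaces require a commutative field, so dimension
   and rank are defined here for matrices over a possibly noncommutative ring.
   Row vectors form a left module, and [u *m A] is the left linear combination
   of the rows of [A] with coefficients [u 0 i] written on the left. *)
Definition left_row_space (R : unitRingType) (m n : nat) (A : 'M[R]_(m, n)) :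
  set 'rV[R]_n := [set v | exists u : 'rV[R]_m, v = u *m A].

Definition left_free (R : unitRingType) (m n : nat) (A : 'M[R]_(m, n)) : Prop :=
  forall u : 'rV[R]_m, u *m A = 0 -> u = 0.

(* The rows of [M] form a basis of the set of row vectors [V]. *)
Definition left_basis (R : unitRingType) (n : nat) (V : set 'rV[R]_n)
  (d : nat) (M : 'M[R]_(d, n)) : Prop :=
  left_free M /\ left_row_space M = V.

(* Over a division ring every left subspace of [R^n] has a basis and all its
   bases have the same size, so the default value 0 of [xget] is not used. *)
Definition left_dim (R : unitRingType) (n : nat) (V : set 'rV[R]_n) : nat :=
  xget 0%N [set d | exists M : 'M[R]_(d, n), left_basis V M].

Definition rk (R : unitRingType) (m n : nat) (A : 'M[R]_(m, n)) : nat :=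
  left_dim (left_row_space A).

Arguments rk {R m n} A%_R.

(* [rowmx a, b, c] is the block row (a b c); [colmx a; b; c] stacks a, b, c. *)
Notation "[ 'rowmx' x , .. , y , z ]" := (row_mx x .. (row_mx y z) ..)
  (at level 0, x, y, z at level 99,
   format "[ 'rowmx'  x ,  .. ,  y ,  z ]") : ring_scope.
Notation "[ 'colmx' x ; .. ; y ; z ]" := (col_mx x .. (col_mx y z) ..)
  (at level 0, x, y, z at level 99,
   format "[ 'colmx'  '[v' x ; '/'  .. ; '/'  y ; '/'  z ']' ]") : ring_scope.

(* Main.v *)
Require Import Defs.
From mathcomp Require Import all_boot all_algebra.
From mathcomp Require Import boolp classical_sets.

(* Each equation prescribes [X] on a subspace of column vectors, modulo another
   subspace: [C *m X *m F = Psi] says that [(u, X *m u)] lies in the linear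
   relation [G3 = {(F r, v) | C v = Psi r}] for [u] in the image of [F], and
   [D *m X *m G = Omega] gives [G4] likewise.  Eliminating [Y] from the first
   equation leaves two nested relations, [G1 = {(E r, v) | A v - Phi r in im B}]
   and [G2 = {(E r, v) | H r = 0, A v = Phi r}].  By Roth's criterion, a rank
   equality says that [P v = T r] is solvable in [v] whenever [Q r = 0]; the
   first eight say that the four relations have the expected domains and
   indeterminacies, and the ten others say that the domain commutes with one of
   the meets [G3 G4], [G1 G3], [G2 G3], [G1 G4], [G2 G4], [G2 (G3 + G4)],
   [(G1 G3) (G1 G4)], [G1 (G3 + G4)], [(G2 G3) (G2 G4)] and
   [G2 (G1 G3 + G1 G4)].  These are precisely what is needed to build [X] by
   successive extensions of a partial linear map, first to the domain of [G2],
   then to that of [G1], and then to those of [G3] and [G4]. *)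

Set Implicit Arguments.
Unset Strict Implicit.
Unset Printing Implicit Defensive.

Import GRing.Theory.
Local Open Scope ring_scope.

(** * Rank of matrices over a division ring *)

Section RankOverDivisionRing.
Variable R : unitRingType.
Hypothesis divR : forall x : R, x != 0 -> x \is a GRing.unit.

(** One step of Gaussian elimination: [w] reads the coefficient along [c] and [W] passes to the
    quotient by the right span of [c]. It drives the inductions of [right_inverse_leq] and
    [extend_partial_map]. *)
Lemma exists_pivot k (c : 'cV[R]_k.+1) : c != 0 ->
  exists (w : 'rV[R]_k.+1) (W : 'M[R]_(k, k.+1)),
    [/\ w *m c = 1%:M, W *m c = 0,
        forall z : 'cV[R]_k.+1, W *m z = 0 -> exists a : 'M[R]_1, z = c *m a
      & exists W' : 'M[R]_(k.+1, k), W *m W' = 1%:M].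
Proof.
case/cV0Pn=> i ci0.
pose w : 'rV[R]_k.+1 := (c i 0)^-1 *: delta_mx 0 i.
have wE n (z : 'M[R]_(k.+1, n)) l : (w *m z) 0 l = (c i 0)^-1 * z i l.
  by rewrite -scalemxAl -rowE !mxE.
have wc : w *m c = 1%:M.
  by apply/rowP=> j; rewrite wE ord1 mulVr ?divR // mxE.
(* Row [i] of the projection [1%:M - c *m w] is zero, so deleting it loses nothing. *)
pose W := row' i (1%:M - c *m w).
have WE n (z : 'M[R]_(k.+1, n)) : W *m z = row' i (z - c *m (w *m z)).
  by rewrite /W row'Esub mul_rowsub_mx -row'Esub mulmxBl mul1mx mulmxA.
have entryE n (z : 'M[R]_(k.+1, n)) j l :
    (z - c *m (w *m z)) j l = z j l - c j 0 * ((c i 0)^-1 * z i l).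
  by rewrite mxE [X in _ + X]mxE [X in _ - X]mxE big_ord1 wE.
exists w, W; split=> //.
- by rewrite WE wc mulmx1 subrr; apply/matrixP=> x y; rewrite !mxE.
- move=> z; rewrite WE => Wz; exists (w *m z).
  apply/eqP; rewrite -subr_eq0; apply/eqP/colP=> j; rewrite [RHS]mxE.
  case: (unliftP i j) => [j' ->|->].
    by move/colP/(_ j'): Wz; rewrite [LHS]mxE [RHS]mxE.
  by rewrite entryE mulrA mulrV ?divR // mul1r subrr.
- exists (col' i 1%:M); apply/matrixP=> j l.
  rewrite WE [LHS]mxE entryE !mxE (negPf (neq_lift i l)) !mulr0 subr0.
  by rewrite (inj_eq lift_inj).
Qed.

(** Invariance of dimension, by induction on [d']: a zero first column of [S] is dropped, and a
    nonzero one is killed by the matrix [W] at the cost of one row. *)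
Lemma right_inverse_leq d d' (S : 'M[R]_(d, d')) (S' : 'M[R]_(d', d)) :
  S *m S' = 1%:M -> (d <= d')%N.
Proof.
elim: d' d S S' => [|d' IH] [|d] S S' //.
  move=> SS1; have: (S *m S') 0 0 = 0 by rewrite mxE big_ord0.
  by rewrite SS1 mxE => /eqP; rewrite oner_eq0.
rewrite -[d'.+1]/(1 + d')%N in S S' *; rewrite -[S]hsubmxK -[S']vsubmxK.
move: (lsubmx _) (rsubmx _) (usubmx _) (dsubmx _) => c S2 s S2'.
rewrite mul_row_col.
have [->|c0] := eqVneq c 0.
  by rewrite mul0mx add0r => /IH /leqW.
have [w [W [_ Wc _ [W' WW']]]] := exists_pivot c0 => E.
have := congr1 (fun M => W *m M *m W') E.
rewrite mulmxDr mulmxA Wc mul0mx add0r mulmx1 WW' => E'.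
by apply: (IH _ (W *m S2) (S2' *m W')); rewrite -E' !mulmxA.
Qed.

(** Full-rank factorization. Independence of the columns of [P] and of the rows of [Q] is encoded by
    one-sided inverses, so that rank computations become matrix identities. *)
Definition rank_factorization m n r (A : 'M[R]_(m, n)) (P : 'M[R]_(m, r))
  (Q : 'M[R]_(r, n)) (P' : 'M[R]_(r, m)) (Q' : 'M[R]_(n, r)) : Prop :=
  [/\ A = P *m Q, P' *m P = 1%:M & Q *m Q' = 1%:M].

Lemma row_right_inverse n (b : 'rV[R]_n) : b != 0 ->
  exists b' : 'cV[R]_n, b *m b' = 1%:M.
Proof.
case/rV0Pn=> j bj; exists (delta_mx j 0 *m (b 0 j)^-1%:M).
rewrite mulmxA -colE; apply/matrixP=> x y.
by rewrite !ord1 !mxE big_ord1 !mxE mulr1n mulrV ?divR.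
Qed.

(** Induction on the rows: a new row [a] either lies in the row space of [Q] or contributes one
    basis row. *)
Lemma rank_factorization_exists m n (A : 'M[R]_(m, n)) :
  exists r P Q P' Q', @rank_factorization m n r A P Q P' Q'.
Proof.
elim: m A => [|h IH] A.
  exists 0%N, 0, 0, 0, 0; split; rewrite [LHS]flatmx0 [RHS]flatmx0; reflexivity.
rewrite -[h.+1]/(1 + h)%N in A *; rewrite -[A]vsubmxK.
move: (usubmx _) (dsubmx _) => a {}A.
have [r [P [Q [P' [Q' [-> PP QQ]]]]]] := IH A.
have [b bE] : exists b, b = a - a *m Q' *m Q by eexists.
have bQ : b *m Q' = 0 by rewrite bE mulmxBl -!mulmxA QQ mulmx1 subrr.
have [b0|/row_right_inverse [b' bb]] := eqVneq b 0.
  exists r, (col_mx (a *m Q') P), Q, (row_mx 0 P'), Q'; split=> //.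
    by rewrite mul_col_mx; congr col_mx; apply/eqP; rewrite -subr_eq0 -bE b0.
  by rewrite mul_row_col mul0mx add0r.
(* Once corrected so that [Q] kills it, the right inverse of [b] combines with [Q'] into one of
   [col_mx b Q]. *)
pose be := b' - Q' *m (Q *m b').
have bbe : b *m be = 1%:M by rewrite mulmxBr bb !mulmxA bQ !mul0mx subr0.
have Qbe : Q *m be = 0 by rewrite mulmxBr !mulmxA QQ mul1mx subrr.
exists (1 + r)%N, (block_mx 1%:M (a *m Q') 0 P), (col_mx b Q),
  (block_mx 1%:M (- (a *m Q' *m P')) 0 P'), (row_mx be Q'); split.
- by rewrite mul_block_col mul1mx mul0mx add0r bE subrK.
- by rewrite mulmx_block !(mulmx0, mul0mx, addr0, add0r, mul1mx) PP mulNmx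
    -(mulmxA _ P') PP mulmx1 subrr -scalar_mx_block.
- by rewrite mul_col_row bbe bQ Qbe QQ -scalar_mx_block.
Qed.

(** The rows of [Q] form a left basis of the row space, and the matrices expressing two bases in
    each other bound each size by the other. *)
Lemma rk_rank_factorization m n r (A : 'M[R]_(m, n)) P Q P' Q' :
  @rank_factorization m n r A P Q P' Q' -> rk A = r.
Proof.
case=> AE PP QQ; rewrite /rk /left_dim.
have basisQ : left_basis (left_row_space A) Q.
  split=> [u uQ|]; first by rewrite -[u]mulmx1 -QQ mulmxA uQ mul0mx.
  apply/seteqP; split=> _ [u ->]; last by exists (u *m P); rewrite AE mulmxA.
  by exists (u *m P'); rewrite AE mulmxA -(mulmxA u) PP mulmx1.
have coeffs d d' (M : 'M[R]_(d, n)) (N : 'M[R]_(d', n)) :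
    left_row_space M = left_row_space N -> exists S, M = S *m N.
  move=> MN; have /choice [f fE] : forall i : 'I_d, exists u, row i M = u *m N.
    move=> i; suff : left_row_space N (row i M) by [].
    by rewrite -MN; exists (delta_mx 0 i); rewrite -rowE.
  exists (\matrix_i f i); apply/row_matrixP=> i.
  by rewrite row_mul rowK fE.
have bases_leq d d' (M : 'M[R]_(d, n)) (N : 'M[R]_(d', n)) :
    left_basis (left_row_space A) M -> left_basis (left_row_space A) N ->
    (d <= d')%N.
  move=> [freeM spanM] [_ spanN].
  have [S MS] := coeffs _ _ _ _ (etrans spanM (esym spanN)).
  have [T NT] := coeffs _ _ _ _ (etrans spanN (esym spanM)).
  apply: (@right_inverse_leq _ _ S T); apply/row_matrixP=> i.
  apply/eqP; rewrite -subr_eq0 -raddfB /=; apply/eqP/freeM.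
  by rewrite -row_mul mulmxBl -mulmxA -NT -MS mul1mx subrr raddf0.
(* The basis [Q] excludes the default value of [xget]. *)
case: xgetP => [d _ [M basisM]|none]; last by case: (none r); exists Q.
by apply/eqP; rewrite eqn_leq (bases_leq _ _ _ _ basisM basisQ)
  (bases_leq _ _ _ _ basisQ basisM).
Qed.

(** With both matrices factored, [P2' *m S *m P] has the right inverse [Q *m T *m Q2']. *)
Lemma rk_mul_leq m n m' n' (A : 'M[R]_(m, n)) (S : 'M[R]_(m', m))
  (T : 'M[R]_(n, n')) : (rk (S *m A *m T) <= rk A)%N.
Proof.
have [r [P [Q [P' [Q' fA]]]]] := rank_factorization_exists A.
have [r2 [P2 [Q2 [P2' [Q2' fB]]]]] := rank_factorization_exists (S *m A *m T).
rewrite (rk_rank_factorization fA) (rk_rank_factorization fB).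
case: fA fB => -> PP QQ [BE PP2 QQ2].
apply: (@right_inverse_leq _ _ (P2' *m S *m P) (Q *m T *m Q2')).
rewrite -[RHS]mulmx1 -{1}PP2 -[in RHS]QQ2 !mulmxA -[in RHS](mulmxA _ P2) -BE.
by rewrite !mulmxA.
Qed.

Lemma rk_equiv m n m' n' (A : 'M[R]_(m, n)) (B : 'M[R]_(m', n')) S T S' T' :
  A = S *m B *m T -> B = S' *m A *m T' -> rk A = rk B.
Proof.
move=> AB BA; apply/eqP; rewrite eqn_leq {1}AB rk_mul_leq.
by rewrite {1}BA rk_mul_leq.
Qed.

Lemma rk_eq0 m n (A : 'M[R]_(m, n)) : (rk A = 0%N) <-> (A = 0).
Proof.
have [r [P [Q [P' [Q' fA]]]]] := rank_factorization_exists A.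
rewrite (rk_rank_factorization fA).
case: fA => AE PP QQ; split=> [r0|A0].
  rewrite AE; move: P Q {P' Q' AE PP QQ}; rewrite r0 => P Q.
  by rewrite flatmx0 mulmx0.
have : P' *m A *m Q' = 1%:M by rewrite AE mulmxA PP mul1mx.
rewrite A0 mulmx0 mul0mx; case: r {P Q P' Q' AE PP QQ} => // r /matrixP/(_ 0 0).
by rewrite !mxE => /esym/eqP; rewrite oner_eq0.
Qed.

(** It yields two idempotents: [A *m A'] projects onto the column space of [A], and [1%:M - A' *m A]
    onto its kernel. *)
Lemma generalized_inverse m n (A : 'M[R]_(m, n)) :
  exists A' : 'M[R]_(n, m), A *m A' *m A = A.
Proof.
have [r [P [Q [P' [Q' [-> PP QQ]]]]]] := rank_factorization_exists A; exists (Q' *m P').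
by rewrite !mulmxA -(mulmxA P) QQ mulmx1 -(mulmxA P) PP mulmx1.
Qed.

(** Modulo the columns of [A], [B] reduces to [K], which [A *m A'] kills. The column spaces of [A]
    and [K] are thus independent, and their factorizations can be put side by side. *)
Lemma rk_row_mxE m n k (A : 'M[R]_(m, n)) A' (B : 'M[R]_(m, k)) :
  A *m A' *m A = A ->
  rk (row_mx A B) = (rk A + rk ((1%:M - A *m A') *m B))%N.
Proof.
move=> AA; set K := _ *m B; have AK : A *m A' *m K = 0.
  by rewrite mulmxA mulmxBr mulmx1 mulmxA AA subrr mul0mx.
have BE : B = A *m (A' *m B) + K by rewrite /K mulmxBl mul1mx mulmxA addrC subrK.
clearbody K.
have [r [P [Q [P' [Q' fA]]]]] := rank_factorization_exists A.
rewrite (rk_rank_factorization fA).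
have [l [T [U [T' [U' fK]]]]] := rank_factorization_exists K.
rewrite (rk_rank_factorization fK).
case: fA fK => AE PP QQ [KE TT UU].
have AP : A *m A' *m P = P by rewrite -[P]mulmx1 -QQ (mulmxA P) -AE mulmxA AA.
have AT : A *m A' *m T = 0.
  by rewrite -[T]mulmx1 -UU (mulmxA T) -KE mulmxA AK mul0mx.
move: {A'}(A *m A') (A' *m B) BE AP AT {AA AK} => e V BE eP eT.
apply: (@rk_rank_factorization _ _ _ _ (row_mx P T) (block_mx Q (Q *m V) 0 U)
  (col_mx (P' *m e) (T' *m (1%:M - e)))
  (block_mx Q' (- (Q' *m (Q *m V *m U'))) 0 U')); split.
- by rewrite mul_row_block mulmx0 addr0 mulmxA -AE -KE -BE.
- rewrite mul_col_row -!mulmxA eP eT !mulmxBl !mul1mx eP eT PP.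
  by rewrite subrr subr0 !mulmx0 TT -scalar_mx_block.
- rewrite mulmx_block !(mulmx0, mul0mx, addr0, add0r) QQ UU mulmxN.
  by rewrite (mulmxA Q) QQ mul1mx addNr -scalar_mx_block.
Qed.

(** The mirror argument, with row spaces and the idempotent [A' *m A]. *)
Lemma rk_col_mxE m n k (A : 'M[R]_(m, n)) A' (B : 'M[R]_(k, n)) :
  A *m A' *m A = A ->
  rk (col_mx A B) = (rk A + rk (B *m (1%:M - A' *m A)))%N.
Proof.
move=> AA; set K := B *m _; have KA : K *m (A' *m A) = 0.
  by rewrite -mulmxA mulmxBl mul1mx -mulmxA (mulmxA A) AA subrr mulmx0.
have BE : B = B *m A' *m A + K by rewrite /K mulmxBr mulmx1 mulmxA addrC subrK.
clearbody K.
have [r [P [Q [P' [Q' fA]]]]] := rank_factorization_exists A.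
rewrite (rk_rank_factorization fA).
have [l [T [U [T' [U' fK]]]]] := rank_factorization_exists K.
rewrite (rk_rank_factorization fK).
case: fA fK => AE PP QQ [KE TT UU].
have QA : Q *m (A' *m A) = Q.
  by rewrite -[Q]mul1mx -PP -!mulmxA (mulmxA P) -AE (mulmxA A) AA.
have UA : U *m (A' *m A) = 0.
  by rewrite -[U]mul1mx -TT -!mulmxA (mulmxA T) -KE KA mulmx0.
move: {A'}(A' *m A) (B *m A') BE QA UA {AA KA} KE => e V BE Qe Ue KE.
apply: (@rk_rank_factorization _ _ _ _ (block_mx P 0 (V *m P) T) (col_mx Q U)
  (block_mx P' 0 (- (T' *m (V *m P) *m P')) T')
  (row_mx (e *m Q') ((1%:M - e) *m U'))); split.
- by rewrite mul_block_col mul0mx addr0 -mulmxA -AE -KE -BE.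
- rewrite mulmx_block !(mulmx0, mul0mx, addr0, add0r) PP TT mulNmx.
  by rewrite -(mulmxA _ P') PP mulmx1 addNr -scalar_mx_block.
- rewrite mul_col_row !mulmxA !mulmxBr !mulmx1 Qe Ue QQ.
  by rewrite subrr subr0 !mul0mx UU -scalar_mx_block.
Qed.

(** * Rank equalities as statements about vectors *)

Lemma solvable_columns m n k (A : 'M[R]_(m, n)) (B : 'M[R]_(m, k)) :
  (forall r : 'cV[R]_k, exists v, A *m v = B *m r) -> exists V, A *m V = B.
Proof.
move=> AB; have /choice [f fE] : forall j : 'I_k, exists v, A *m v = col j B.
  by move=> j; rewrite colE.
exists (\matrix_(i, j) f j i 0); apply/matrixP=> i j.
move/colP/(_ i): (fE j); rewrite !mxE => <-.
by apply: eq_bigr => x _; rewrite !mxE.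
Qed.

Lemma rk_col_mx m n k (A : 'M[R]_(m, n)) (B : 'M[R]_(k, n)) :
  rk (col_mx A B) = rk A <-> (forall r : 'cV[R]_n, A *m r = 0 -> B *m r = 0).
Proof.
have [A' AA] := generalized_inverse A; rewrite (rk_col_mxE _ AA).
rewrite -[X in _ = X]addn0; split=> [/addnI/rk_eq0 B0 r Ar|B0].
  move/eqP: B0; rewrite mulmxBr mulmx1 subr_eq0 => /eqP ->.
  by rewrite -!mulmxA Ar !mulmx0.
congr addn; apply/rk_eq0/matrixP=> i j.
have := B0 (col j (1%:M - A' *m A)); rewrite !colE !mulmxA.
rewrite mulmxBr mulmx1 mulmxA AA subrr mul0mx => /(_ erefl).
by rewrite -colE => /colP/(_ i); rewrite !mxE.
Qed.

Lemma rk_row_mx m n k (A : 'M[R]_(m, n)) (B : 'M[R]_(m, k)) :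
  rk (row_mx A B) = rk A <-> (forall r : 'cV[R]_k, exists v, A *m v = B *m r).
Proof.
have [A' AA] := generalized_inverse A; rewrite (rk_row_mxE _ AA).
rewrite -[X in _ = X]addn0; split=> [/addnI/rk_eq0 B0 r|/solvable_columns [V <-]].
  move/eqP: B0; rewrite mulmxBl mul1mx subr_eq0 => /eqP ->.
  by exists (A' *m B *m r); rewrite !mulmxA.
by congr addn; apply/rk_eq0; rewrite mulmxA mulmxBl mul1mx AA subrr mul0mx.
Qed.

Lemma rk_row_mxC m n k (A : 'M[R]_(m, n)) (B : 'M[R]_(m, k)) :
  rk (row_mx A B) = rk (row_mx B A).
Proof.
by apply: (@rk_equiv _ _ _ _ _ _ 1%:M (block_mx 0 1%:M 1%:M 0) 1%:M
  (block_mx 0 1%:M 1%:M 0));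
  rewrite mul1mx mul_row_block !(mulmx0, mulmx1, addr0, add0r).
Qed.

Lemma rk_col_mxC m n k (A : 'M[R]_(m, n)) (B : 'M[R]_(k, n)) :
  rk (col_mx A B) = rk (col_mx B A).
Proof.
by apply: (@rk_equiv _ _ _ _ _ _ (block_mx 0 1%:M 1%:M 0) 1%:M
  (block_mx 0 1%:M 1%:M 0) 1%:M);
  rewrite mulmx1 mul_block_col !(mul0mx, mul1mx, addr0, add0r).
Qed.

(* Roth's criterion for the solvability of [T = P *m U + V *m Q]. *)
Lemma rk_roth m n m' n' (T : 'M[R]_(m, n)) (P : 'M[R]_(m, n'))
  (Q : 'M[R]_(m', n)) :
  rk (block_mx P T 0 Q) = (rk P + rk Q)%N <->
  (forall r, Q *m r = 0 -> exists v : 'cV[R]_n', P *m v = T *m r).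
Proof.
have [P' PP] := generalized_inverse P; have [Q' QQ] := generalized_inverse Q.
(* The excess over [rk P + rk Q] is the rank of [T] restricted to the kernel of [Q] and taken modulo
   the columns of [P]. *)
have -> : rk (block_mx P T 0 Q) =
    (rk P + (rk Q + rk ((1%:M - P *m P') *m T *m (1%:M - Q' *m Q))))%N.
  rewrite block_mxEh (@rk_row_mxE _ _ _ _ (row_mx P' 0)).
    congr addn; first by apply/rk_col_mx => r _; rewrite mul0mx.
    rewrite mul_col_row !(mulmx0, mul0mx) [1%:M]scalar_mx_block opp_block_mx.
    rewrite add_block_mx !(oppr0, addr0) mul_block_col !mul0mx addr0 add0r mul1mx.
    by rewrite rk_col_mxC (rk_col_mxE _ QQ).
  by rewrite -mulmxA mul_row_col mul0mx addr0 mul_col_mx mul0mx mulmxA PP.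
rewrite addnA -[X in _ = X]addn0; split=> [/addnI/rk_eq0 T0 r Qr|TPQ].
  have rE : (1%:M - Q' *m Q) *m r = r.
    by rewrite mulmxBl mul1mx -mulmxA Qr mulmx0 subr0.
  have : (1%:M - P *m P') *m T *m r = 0 by rewrite -{1}rE mulmxA T0 mul0mx.
  rewrite !mulmxBl mul1mx => /eqP; rewrite subr_eq0 => /eqP ->.
  by exists (P' *m (T *m r)); rewrite !mulmxA.
congr addn; apply/rk_eq0.
have [r|V PV] := @solvable_columns _ _ _ P (T *m (1%:M - Q' *m Q)).
  rewrite -mulmxA; apply: TPQ.
  by rewrite mulmxA mulmxBr mulmx1 mulmxA QQ subrr mul0mx.
by rewrite -mulmxA -PV mulmxA mulmxBl mul1mx PP subrr mul0mx.
Qed.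

(** * Regrouping of blocks *)

Lemma rk_castmx m n m' n' (e : (m = m') * (n = n')) (A : 'M[R]_(m, n)) :
  rk (castmx e A) = rk A.
Proof. by case: e => em en; case: _ / em; case: _ / en; rewrite castmx_id. Qed.

Lemma rk_row_mxA m n k l (A : 'M[R]_(m, n)) (B : 'M[R]_(m, k)) (C : 'M[R]_(m, l)) :
  rk (row_mx A (row_mx B C)) = rk (row_mx (row_mx A B) C).
Proof. by rewrite row_mxA rk_castmx. Qed.

Lemma rk_col_mxA m n k l (A : 'M[R]_(n, m)) (B : 'M[R]_(k, m)) (C : 'M[R]_(l, m)) :
  rk (col_mx A (col_mx B C)) = rk (col_mx (col_mx A B) C).
Proof. by rewrite col_mxA rk_castmx. Qed.

Lemma col_row_mx m1 m2 n1 n2 (A : 'M[R]_(m1, n1)) (B : 'M[R]_(m1, n2))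
    (C : 'M[R]_(m2, n1)) (D : 'M[R]_(m2, n2)) :
  col_mx (row_mx A B) (row_mx C D) = row_mx (col_mx A C) (col_mx B D).
Proof. by rewrite -block_mxEh block_mxEv. Qed.

End RankOverDivisionRing.

(** * Selecting a linear map from linear relations *)

Section LinearRelations.
Variable R : unitRingType.
Hypothesis divR : forall x : R, x != 0 -> x \is a GRing.unit.
Variables n p : nat.

Definition relation := 'cV[R]_n -> 'cV[R]_p -> Prop.

(* Scalars act on columns from the right, hence are [1 x 1] matrices. *)
Definition linear_rel (G : relation) : Prop :=
  G 0 0 /\ forall u v u' v' (a : 'M[R]_1),
    G u v -> G u' v' -> G (u + u' *m a) (v + v' *m a).

Definition sub_rel (G K : relation) : Prop := forall u v, G u v -> K u v.

Definition dom (G : relation) u : Prop := exists v, G u v.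

Definition meet (G K : relation) : relation := fun u v => G u v /\ K u v.

(** The sum of the two relations as subspaces of the product space. *)
Definition join (G K : relation) : relation := fun u v =>
  exists u1 v1 u2 v2, [/\ G u1 v1, K u2 v2, u = u1 + u2 & v = v1 + v2].

(** The converse inclusion is automatic, so the domain of the meet is then the intersection of the
    domains. *)
Definition dom_meet (G K : relation) : Prop :=
  forall u, dom G u -> dom K u -> dom (meet G K) u.

(* Domains of partial maps are given by equations, so that the induction that
   enlarges a domain is on the number of equations. *)
Definition partial_map (g : relation) : Prop :=
  exists k (L : 'M[R]_(k, n)) (X : 'M[R]_(p, n)),
    forall u v, g u v <-> L *m u = 0 /\ v = X *m u.

(** Agreement on the common domain only; [selects] also demands that [g] be defined on all of
    [dom G]. *)
Definition compatible (g G : relation) : Prop :=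
  forall u v, g u v -> dom G u -> G u v.

Definition selects (g G : relation) : Prop :=
  forall u, dom G u -> exists2 v, g u v & G u v.

Lemma linear_relD G u v u' v' :
  linear_rel G -> G u v -> G u' v' -> G (u + u') (v + v').
Proof.
by move=> [_ GL] Guv Guv'; have := GL _ _ _ _ 1%:M Guv Guv'; rewrite !mulmx1.
Qed.

Lemma linear_relB G u v u' v' :
  linear_rel G -> G u v -> G u' v' -> G (u - u') (v - v').
Proof.
move=> [_ GL] Guv Guv'; have := GL _ _ _ _ (- 1%:M) Guv Guv'.
by rewrite !mulmxN !mulmx1.
Qed.

Lemma linear_meet G K : linear_rel G -> linear_rel K -> linear_rel (meet G K).
Proof.
move=> [G0 GL] [K0 KL]; split=> // u v u' v' a [Gu Ku] [Gu' Ku'].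
by split; [apply: GL|apply: KL].
Qed.

Lemma linear_join G K : linear_rel G -> linear_rel K -> linear_rel (join G K).
Proof.
move=> [G0 GL] [K0 KL]; split=> [|u v u' v' a].
  by exists 0, 0, 0, 0; rewrite !addr0.
move=> [u1 [v1 [u2 [v2 [G1 K2 -> ->]]]]] [u3 [v3 [u4 [v4 [G3 K4 -> ->]]]]].
exists (u1 + u3 *m a), (v1 + v3 *m a), (u2 + u4 *m a), (v2 + v4 *m a).
by split; [exact: GL|exact: KL| |]; by rewrite mulmxDl addrACA.
Qed.

Lemma linear_partial_map g : partial_map g -> linear_rel g.
Proof.
move=> [k [L [X gE]]]; split=> [|u v u' v' a /gE [Lu ->] /gE [Lu' ->]].
  by apply/gE; rewrite !mulmx0.
by apply/gE; rewrite !mulmxDr !mulmxA Lu Lu' mul0mx addr0.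
Qed.

Lemma partial_map_fun g u v v' : partial_map g -> g u v -> g u v' -> v = v'.
Proof. by move=> [k [L [X gE]]] /gE [_ ->] /gE [_ ->]. Qed.

Lemma sub_joinl G K : linear_rel K -> sub_rel G (join G K).
Proof. by move=> [K0 _] u v Gu; exists u, v, 0, 0; rewrite !addr0. Qed.

Lemma sub_joinr G K : linear_rel G -> sub_rel K (join G K).
Proof. by move=> [G0 _] u v Ku; exists 0, 0, u, v; rewrite !add0r. Qed.

Lemma join_sub G K J :
  linear_rel J -> sub_rel G J -> sub_rel K J -> sub_rel (join G K) J.
Proof.
move=> Jl GJ KJ _ _ [u1 [v1 [u2 [v2 [/GJ J1 /KJ J2 -> ->]]]]].
exact: linear_relD.
Qed.

Lemma selects_sub g g' G : sub_rel g g' -> selects g G -> selects g' G.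
Proof. by move=> gg' gG u /gG [v /gg' guv Guv]; exists v. Qed.

(** As long as some [e] in [dom G] violates an equation of the domain, a value of [G] at [e] is
    adopted and one equation disappears. The bound by [join g G] records that only elements of [G]
    are added, which later compatibility checks need. *)
Lemma extend_partial_map g G : partial_map g -> linear_rel G -> compatible g G ->
  exists g', [/\ partial_map g', sub_rel g g', selects g' G & sub_rel g' (join g G)].
Proof.
move=> [k [L [X gE]]] Gl; elim: k L X g gE => [|k IH] L X g gE gG.
  have pg : partial_map g by exists 0%N, L, X.
  exists g; split=> //; last exact: sub_joinl.
  move=> u Gu; have guv : g u (X *m u) by apply/gE; rewrite [LHS]flatmx0.
  by exists (X *m u) => //; apply: gG.
have [[e [v Gev] Le]|noe] := EM (exists2 e, dom G e & L *m e != 0); last first.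
  have pg : partial_map g by exists k.+1, L, X.
  exists g; split=> //; last exact: sub_joinl.
  move=> u Gu; have guv : g u (X *m u).
    apply/gE; split=> //; apply/eqP; apply: contra_notT noe => Lu.
    by exists u.
  by exists (X *m u) => //; apply: gG.
have [w [W [wL WL kerW _]]] := exists_pivot divR Le.
(* The correction vanishes on the kernel of [L] and, as [w *m L *m e] is 1, it moves the value at
   [e] to [v]. *)
pose X1 := X + (v - X *m e) *m (w *m L).
have X1E u : X1 *m u = X *m u + (v - X *m e) *m (w *m (L *m u)).
  by rewrite mulmxDl !mulmxA.
pose g1 : relation := fun u v => (W *m L) *m u = 0 /\ v = X1 *m u.
have X1e : X1 *m e = v by rewrite X1E wL mulmx1 addrC subrK.
have X1k (s : 'cV_n) : L *m s = 0 -> X1 *m s = X *m s.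
  by move=> Ls; rewrite X1E Ls !mulmx0 addr0.
have g1E u v' : g1 u v' ->
    exists s a, [/\ g s (X *m s), u = s + e *m a & v' = X *m s + v *m a].
  rewrite /g1 -mulmxA => -[/kerW [a Lu] ->].
  have Ls : L *m (u - e *m a) = 0 by rewrite mulmxBr Lu mulmxA subrr.
  exists (u - e *m a), a; split; rewrite ?subrK //; first by apply/gE.
  by rewrite -(X1k _ Ls) -X1e -mulmxA -mulmxDr subrK.
have gg1 : sub_rel g g1.
  by move=> u _ /gE [Lu ->]; split; rewrite ?X1k // -mulmxA Lu mulmx0.
(* For [u = s + e *m a] in [dom G], [s] is in [dom G] too; compatibility at [s] plus a multiple of
   [(e, v)] gives it at [u]. *)
have [|g' [pg' g1g' g'G g'sub]] := IH (W *m L) X1 g1 (fun _ _ => iff_refl _).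
  move=> u v' /g1E [s [a [gs uE ->]]] [x Gux]; rewrite uE.
  have := proj2 Gl _ _ _ _ (- a) Gux Gev; rewrite uE !mulmxN addrK => Gs.
  by apply: (proj2 Gl) => //; apply: gG => //; eexists; exact: Gs.
exists g'; split=> // [u v' /gg1 /g1g'|] //.
have gl : linear_rel g by apply: linear_partial_map; exists k.+1, L, X.
move=> u v' /g'sub; apply: join_sub; first exact: linear_join.
  move=> {u v'} u v' /g1E [s [a [gs -> ->]]].
  exists s, (X *m s), (e *m a), (v *m a); split=> //.
  by have := proj2 Gl _ _ _ _ a (proj1 Gl) Gev; rewrite !add0r.
exact: sub_joinr.
Qed.

(** If [g] lies in [G], so does [join g G], and hence the whole extension. *)
Lemma extend_inside g G : partial_map g -> linear_rel G -> sub_rel g G ->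
  exists g', [/\ partial_map g', sub_rel g g', sub_rel g' G
               & forall u, dom G u -> dom g' u].
Proof.
move=> pg Gl gG.
have [|g' [pg' gg' g'G g'sub]] := extend_partial_map pg Gl.
  by move=> u v /gG.
exists g'; split=> // [u v /g'sub|u /g'G [v g'v _]]; last by exists v.
exact: join_sub.
Qed.

(* Before [G] is selected, the values on those [b] in [dom G] that become
   congruent to an element of [dom K] modulo [dom g] are taken in
   [meet G (join g K)], so that the later choice for [K] is not obstructed. *)
Lemma extend_pair g G K : partial_map g -> linear_rel G -> linear_rel K ->
    compatible g G -> compatible g K -> compatible g (join G K) ->
    dom_meet G K ->
  exists g', [/\ partial_map g', sub_rel g g', selects g' G, selects g' K
               & sub_rel g' (join g (join G K))].
Proof.
move=> pg Gl Kl gG gK gGK domGK.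
have gl := linear_partial_map pg; have gKl := linear_join gl Kl.
have Dl := linear_meet Gl gKl.
have [|g1 [pg1 gg1 g1D g1sub]] := extend_partial_map pg Dl.
  move=> u v guv [v' [Guv' _]]; split; first by apply: gG => //; exists v'.
  exact: sub_joinl.
have g1l := linear_partial_map pg1.
have [|g2 [pg2 g12 g2G g2sub]] := extend_partial_map pg1 Gl.
  move=> u v /g1sub [s [vs [d [vd [gs [Gd _] -> ->]]]]] [v' Gu].
  apply: linear_relD => //; apply: gG => //.
  by exists (v' - vd); have := linear_relB Gl Gu Gd; rewrite addrK.
have g2l := linear_partial_map pg2.
have g2sub' : sub_rel g2 (join g G).
  move=> u v /g2sub; apply: join_sub; first exact: linear_join.
    move=> {u v} u v /g1sub; apply: join_sub; first exact: linear_join.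
      exact: sub_joinl.
    by move=> ? ? [? _]; apply: sub_joinr.
  exact: sub_joinr.
(* The delicate check: [g2] has to be compatible with [K]. A point [u] of both domains is split as
   [s + b], with [s] in the domain of [g] and [b] in that of [G]. *)
have [|g3 [pg3 g23 g3K g3sub]] := extend_partial_map pg2 Kl.
  move=> u v g2u [vu Ku].
  have [s [vs [b [vb [gs Gb uE vE]]]]] := g2sub' _ _ g2u.
  have /(gGK _ _ gs) [b' [x [u' [y [Gb' Ku' sE vsE]]]]] : dom (join G K) s.
    exists (vu - vb), (- b), (- vb), u, vu; split=> //; last by rewrite addrC.
      by have := linear_relB Gl (proj1 Gl) Gb; rewrite !sub0r.
    by rewrite uE addrC addrK.
  have bE : b + b' = u - u' by rewrite uE sE [in RHS]addrAC addrK addrC.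
  (* Since [b + b' = u - u'] is in both domains, it has a common value [z], and [z - x] is then an
     admissible value at [b] for [meet G (join g K)]. *)
  have [z [Gz Kz]] : dom (meet G K) (b + b').
    apply: domGK; first by exists (vb + x); apply: linear_relD.
    by exists (vu - y); rewrite bE; apply: linear_relB.
  have /g1D [c g1b [_ [s' [vs' [k [vk [gs' Kk bE' cE]]]]]]] :
      dom (meet G (join g K)) b.
    exists (z - x); split; first by have := linear_relB Gl Gz Gb'; rewrite addrK.
    exists (- s), (- vs), u, (z + y); split.
    - by have := linear_relB gl (proj1 gl) gs; rewrite !sub0r.
    - by have := linear_relD Kl Kz Ku'; rewrite bE subrK.
    - by rewrite uE addKr.
    - by rewrite vsE opprD addrCA addrA addrA subrK addrC.
  (* The value at [b] was therefore fixed already by [g1], which brings it into [join g K]. *)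
  have vbE : vb = c.
    apply: (partial_map_fun pg2 _ (g12 _ _ g1b)).
    have := linear_relB g2l g2u (g12 _ _ (gg1 _ _ gs)).
    by rewrite uE vE ![_ + _ - _]addrAC !subrr !add0r.
  rewrite uE vE vbE bE' cE !addrA; apply: linear_relD => //.
  apply: gK; first exact: linear_relD.
  exists (vu - vk); have := linear_relB Kl Ku Kk.
  by rewrite {1}uE {1}bE' addrA addrK.
exists g3; split=> //.
- by move=> u v /gg1 /g12 /g23.
- exact: selects_sub g2G.
have GKl := linear_join Gl Kl; have Jl := linear_join gl GKl.
move=> u v /g3sub; apply: join_sub => // {}u {}v.
  move/g2sub'; apply: join_sub => //; first exact: sub_joinl.
  by move=> {}u {}v /(sub_joinl Kl) /(sub_joinr gl).
by move=> /(sub_joinr Gl) /(sub_joinr gl).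
Qed.

(** Inside [G2], and then inside [G1], the smaller relations that constrain later choices are served
    first. As partial maps are single-valued, the final values agree with these early ones. *)
Lemma common_selection (G1 G2 G3 G4 : relation) :
    linear_rel G1 -> linear_rel G2 -> linear_rel G3 -> linear_rel G4 ->
    sub_rel G2 G1 ->
    dom_meet G3 G4 -> dom_meet G1 G3 -> dom_meet G2 G3 ->
    dom_meet G1 G4 -> dom_meet G2 G4 ->
    dom_meet G2 (join G3 G4) -> dom_meet G1 (join G3 G4) ->
    dom_meet (meet G1 G3) (meet G1 G4) -> dom_meet (meet G2 G3) (meet G2 G4) ->
    dom_meet G2 (join (meet G1 G3) (meet G1 G4)) ->
  exists X : 'M[R]_(p, n), forall u,
    [/\ dom G1 u -> G1 u (X *m u), dom G2 u -> G2 u (X *m u),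
        dom G3 u -> G3 u (X *m u) & dom G4 u -> G4 u (X *m u)].
Proof.
move=> l1 l2 l3 l4 G21 d34 d13 d23 d14 d24 d2_34 d1_34 d134 d234 d2_1314.
have l13 := linear_meet l1 l3; have l14 := linear_meet l1 l4.
have l23 := linear_meet l2 l3; have l24 := linear_meet l2 l4.
have l34 := linear_join l3 l4; have l1314 := linear_join l13 l14.
(* The identity as system of equations gives the zero domain. *)
pose g0 : relation := fun u v => 1%:M *m u = 0 /\ v = 0 *m u.
have p0 : partial_map g0 by exists n, 1%:M, 0.
have sub0 G : linear_rel G -> sub_rel g0 G.
  by move=> [G0 _] u v [+ ->]; rewrite mul1mx mul0mx => ->.
have cpt0 G : linear_rel G -> compatible g0 G by move=> Gl u v /(sub0 _ Gl).
have c0_J : compatible g0 (join (meet G2 G3) (meet G2 G4)).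
  by apply: cpt0; apply: linear_join.
have [] := extend_pair p0 l23 l24 (cpt0 _ l23) (cpt0 _ l24) c0_J d234.
move=> g1 [p1 _ s1_23 s1_24 sub1].
(* The maps [g1] to [g4] climb an increasing chain of relations inside [G2], ending with all of
   [dom G2]. *)
have [||g2 [p2 g12 sub2 dom2]] :=
    @extend_inside g1 (meet G2 (join (meet G1 G3) (meet G1 G4))) p1.
- exact: linear_meet.
- have Dl := linear_meet l2 l1314.
  move=> u v /sub1; apply: (join_sub Dl (sub0 _ Dl)); apply: (join_sub Dl).
    move=> {}u {}v [H2 H3]; split=> //; apply: sub_joinl => //.
    by split=> //; apply: G21.
  move=> {}u {}v [H2 H4]; split=> //; apply: sub_joinr => //.
  by split=> //; apply: G21.
have [||g3 [p3 g23 sub3 dom3]] := @extend_inside g2 (meet G2 (join G3 G4)) p2.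
- exact: linear_meet.
- move=> u v /sub2 [H2 HJ]; split=> //; move: HJ; apply: join_sub => //.
    by move=> {H2} {}u {}v [_ /(sub_joinl l4)].
  by move=> {H2} {}u {}v [_ /(sub_joinr l3)].
have [|g4 [p4 g34 sub4 dom4]] := @extend_inside g3 G2 p3 l2.
  by move=> u v /sub3 [].
have g14 : sub_rel g1 g4 by move=> u v /g12 /g23 /g34.
have dom_g4 u v : g4 u v -> dom G2 u by move/sub4; exists v.
have fun4 u v v' := @partial_map_fun g4 u v v' p4.
have c4_34 : compatible g4 (join G3 G4).
  move=> u v gu Ju; have [v' g3u] := dom3 _ (d2_34 _ (dom_g4 _ _ gu) Ju).
  by rewrite (fun4 _ _ _ gu (g34 _ _ g3u)); case: (sub3 _ _ g3u).
have c4_1314 : compatible g4 (join (meet G1 G3) (meet G1 G4)).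
  move=> u v gu Ju; have [v' g2u] := dom2 _ (d2_1314 _ (dom_g4 _ _ gu) Ju).
  by rewrite (fun4 _ _ _ gu (g34 _ _ (g23 _ _ g2u))); case: (sub2 _ _ g2u).
have c4_13 : compatible g4 (meet G1 G3).
  move=> u v gu [x [_ x3]]; split; first exact/G21/sub4.
  have d3 : dom G3 u by exists x.
  have [y g1u [_ y3]] := s1_23 _ (d23 _ (dom_g4 _ _ gu) d3).
  by rewrite (fun4 _ _ _ gu (g14 _ _ g1u)).
have c4_14 : compatible g4 (meet G1 G4).
  move=> u v gu [x [_ x4]]; split; first exact/G21/sub4.
  have d4 : dom G4 u by exists x.
  have [y g1u [_ y4]] := s1_24 _ (d24 _ (dom_g4 _ _ gu) d4).
  by rewrite (fun4 _ _ _ gu (g14 _ _ g1u)).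
have [g5 [p5 g45 s5_13 s5_14 sub5]] :=
  extend_pair p4 l13 l14 c4_13 c4_14 c4_1314 d134.
have l1_34 := linear_meet l1 l34.
have sub1314 : sub_rel (join (meet G1 G3) (meet G1 G4)) (meet G1 (join G3 G4)).
  apply: join_sub => // u v [H1 H]; split=> //; first exact: sub_joinl.
  exact: sub_joinr.
have sub51 : sub_rel g5 G1.
  move=> u v /sub5; apply: join_sub => // {}u {}v; first by move/sub4/G21.
  by case/sub1314.
(* As [g5] is defined on all of [dom G2], it need not lie in [join G3 G4]; compatibility replaces
   inclusion here. *)
have [|g6 [p6 g56 s6 sub6]] := extend_partial_map p5 l1_34.
  move=> u v gu [y [_ Jy]]; split; first exact: sub51.
  have [s [vs [b [vb [gs /sub1314 [_ Jb] uE ->]]]]] := sub5 _ _ gu.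
  rewrite uE; apply: linear_relD => //; apply: c4_34 => //.
  by exists (y - vb); have := linear_relB l34 Jy Jb; rewrite uE addrK.
have [|g7 [p7 g67 sub7 dom7]] := extend_inside p6 l1.
  by move=> u v /sub6; apply: join_sub => // {}u {}v [].
have dom_g7 u v : g7 u v -> dom G1 u by move/sub7; exists v.
have fun7 u v v' := @partial_map_fun g7 u v v' p7.
have c7_3 : compatible g7 G3.
  move=> u v gu d3; have [y gy [_ y3]] := s5_13 _ (d13 _ (dom_g7 _ _ gu) d3).
  by rewrite (fun7 _ _ _ gu (g67 _ _ (g56 _ _ gy))).
have c7_4 : compatible g7 G4.
  move=> u v gu d4; have [y gy [_ y4]] := s5_14 _ (d14 _ (dom_g7 _ _ gu) d4).
  by rewrite (fun7 _ _ _ gu (g67 _ _ (g56 _ _ gy))).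
have c7_34 : compatible g7 (join G3 G4).
  move=> u v gu dJ; have [y gy [_ yJ]] := s6 _ (d1_34 _ (dom_g7 _ _ gu) dJ).
  by rewrite (fun7 _ _ _ gu (g67 _ _ gy)).
have [g8 [p8 g78 s8_3 s8_4 _]] := extend_pair p7 l3 l4 c7_3 c7_4 c7_34 d34.
have [k [L [X gE]]] := p8; exists X => u; split.
- by move=> /dom7 [v g7u]; have /gE [_ <-] := g78 _ _ g7u; apply: sub7.
- move=> /dom4 [v g4u].
  have /gE [_ <-] := g78 _ _ (g67 _ _ (g56 _ _ (g45 _ _ g4u))).
  exact: sub4.
- by move=> /s8_3 [v /gE [_ ->]].
- by move=> /s8_4 [v /gE [_ ->]].
Qed.

End LinearRelations.

(** * Rank equalities as solvability conditions *)

Section RankConditions.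
Variable R : unitRingType.
Hypothesis divR : forall x : R, x != 0 -> x \is a GRing.unit.

(** A form of Roth's criterion suited to displayed matrices: the zero corner may itself be made of
    blocks, and blocks may be regrouped or permuted on both sides. *)
Lemma rk_rothP m n m' n' a b d (P : 'M[R]_(m, n')) (T : 'M[R]_(m, n))
  (Z : 'M[R]_(m', n')) (Q : 'M[R]_(m', n)) (M : 'M[R]_(a, b)) :
  Z = 0 -> rk M = rk (block_mx P T Z Q) -> d = (rk P + rk Q)%N ->
  rk M = d <->
  (forall r, Q *m r = 0 -> exists v : 'cV[R]_n', P *m v = T *m r).
Proof. by move=> -> -> ->; apply: rk_roth. Qed.

Local Notation simp := (mul_col_mx, mul_row_col, mul0mx, addr0, add0r, mulmxN,
  mulNmx, opprK).

Local Notation block_simp := (mul_col_mx, mul_mx_row, mul_row_col, add_row_mx,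
  mul0mx, mulmx0, mul1mx, mulmx1, mulNmx, mulmxN, opp_row_mx, opprK, oppr0,
  addr0, add0r).

Lemma col_mx_eq0P m n k (A : 'M[R]_(m, k)) (B : 'M[R]_(n, k)) :
  col_mx A B = 0 <-> A = 0 /\ B = 0.
Proof. by rewrite -col_mx0; split=> [/eq_col_mx|[-> ->]]. Qed.

Variables (m p q s t p1 q1 m1 s1 t1 : nat).
Variables (A : 'M[R]_(m, p)) (B : 'M[R]_(m, q)) (C : 'M[R]_(s, p))
  (D : 'M[R]_(t, p)) (E : 'M[R]_(p1, m1)) (F : 'M[R]_(p1, s1))
  (G : 'M[R]_(p1, t1)) (H : 'M[R]_(q1, m1)) (Phi : 'M[R]_(m, m1))
  (Psi : 'M[R]_(s, s1)) (Omega : 'M[R]_(t, t1)).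

(** * The individual rank equalities *)

Lemma rk_Phi_A_H :
  rk [colmx [rowmx Phi, A]; [rowmx H, 0]] = (rk A + rk H)%N <->
  (forall r, H *m r = 0 -> exists v : 'cV_p, A *m v = Phi *m r).
Proof.
by apply: (rk_rothP erefl) => //; rewrite !col_row_mx rk_row_mxC // /block_mx col_row_mx.
Qed.

Lemma rk_A_B_Phi :
  rk [rowmx A, B, Phi] = rk [rowmx A, B] <->
  (forall r : 'cV_m1, exists (v : 'cV_p) (w : 'cV_q), A *m v + B *m w = Phi *m r).
Proof.
rewrite rk_row_mxA rk_row_mx //; split=> AB r.
  have [v] := AB r; rewrite -[v]vsubmxK mul_row_col => <-.
  by exists (usubmx v), (dsubmx v).
by have [v [w <-]] := AB r; exists (col_mx v w); rewrite mul_row_col.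
Qed.

Lemma rk_E_H_Phi :
  rk [colmx E; H; Phi] = rk [colmx E; H] <->
  (forall r : 'cV_m1, E *m r = 0 -> H *m r = 0 -> Phi *m r = 0).
Proof.
rewrite rk_col_mxA rk_col_mx //; split=> EH r.
  by move=> Er Hr; apply: EH; rewrite mul_col_mx Er Hr col_mx0.
by rewrite mul_col_mx => /col_mx_eq0P [Er Hr]; apply: EH.
Qed.

Lemma rk_C_D :
  rk [colmx [rowmx Psi, 0, C]; [rowmx 0, -Omega, D]; [rowmx F, G, 0]]
    = (rk [colmx C; D] + rk [rowmx F, G])%N <->
  (forall r2 r3, F *m r2 = G *m r3 ->
     exists v : 'cV_p, C *m v = Psi *m r2 /\ D *m v = Omega *m r3).
Proof.
rewrite (@rk_rothP _ _ _ _ _ _ _ [colmx C; D]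
  [colmx [rowmx Psi, 0]; [rowmx 0, - Omega]] 0 [rowmx F, G]) //; last first.
  rewrite /block_mx !col_row_mx rk_row_mxA rk_row_mxC //.
  by rewrite -!col_row_mx -rk_col_mxA !col_row_mx.
split=> CD.
  (* Negating [r3] turns the equality into a kernel condition and absorbs the sign of [-Omega]. *)
  move=> r2 r3 FG; have [|v] := CD (col_mx r2 (- r3)).
    by rewrite !simp FG subrr.
  by rewrite !simp => /eq_col_mx; exists v.
move=> r; rewrite -[r]vsubmxK !simp => /eqP; rewrite addr_eq0.
rewrite -(mulmxN G) => /eqP.
by move/CD=> [v [Cv Dv]]; exists v; rewrite !simp Cv Dv mulmxN.
Qed.

(** The condition for [G1 G3]; substituting [D], [G], [Omega] for [C], [F], [Psi] gives [G1 G4]. *)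
Lemma rk_AB_C :
  rk [colmx [rowmx 0, 0, E, F]; [rowmx A, B, -Phi, 0]; [rowmx C, 0, 0, Psi]]
    = (rk [colmx [rowmx A, B]; [rowmx C, 0]] + rk [rowmx E, F])%N <->
  (forall r1 r2, E *m r1 = F *m r2 -> exists (v : 'cV_p) (w : 'cV_q),
     A *m v + B *m w = Phi *m r1 /\ C *m v = Psi *m r2).
Proof.
rewrite (@rk_rothP _ _ _ _ _ _ _ [colmx [rowmx A, B]; [rowmx C, 0]]
  [colmx [rowmx -Phi, 0]; [rowmx 0, Psi]] [rowmx 0, 0] [rowmx E, F]) //.
- split=> ABC.
    move=> r1 r2 EF; have [|v] := ABC (col_mx (- r1) r2).
      by rewrite !simp EF addNr.
    rewrite -[v]vsubmxK !simp => /eq_col_mx.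
    by exists (usubmx v), (dsubmx v).
  move=> r; rewrite -[r]vsubmxK; move: (usubmx r) (dsubmx r) => r1 r2 {r}.
  rewrite !simp => /eqP; rewrite addrC addr_eq0 -(mulmxN E) => /eqP/esym/ABC.
  by move=> [v [w [Av Cv]]]; exists (col_mx v w); rewrite !simp Av Cv mulmxN.
- by rewrite row_mx0.
- by rewrite /block_mx [RHS]rk_col_mxC // !col_row_mx rk_row_mxA.
Qed.

Lemma rk_A_C_H :
  rk [colmx [rowmx 0, E, F]; [rowmx 0, H, 0]; [rowmx A, -Phi, 0];
            [rowmx C, 0, Psi]]
    = (rk [colmx [rowmx E, F]; [rowmx H, 0]] + rk [colmx A; C])%N <->
  (forall r1 r2, E *m r1 = F *m r2 -> H *m r1 = 0 ->
     exists v : 'cV_p, A *m v = Phi *m r1 /\ C *m v = Psi *m r2).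
Proof.
rewrite (@rk_rothP _ _ _ _ _ _ _ [colmx A; C]
  [colmx [rowmx -Phi, 0]; [rowmx 0, Psi]] [colmx 0; 0]
  [colmx [rowmx E, F]; [rowmx H, 0]]) //.
- split=> AC.
    move=> r1 r2 EF Hr; have [|v] := AC (col_mx (- r1) r2).
      by rewrite !simp EF Hr addNr oppr0 col_mx0.
    by rewrite !simp => /eq_col_mx; exists v.
  move=> r; rewrite -[r]vsubmxK; move: (usubmx r) (dsubmx r) => r1 r2 {r}.
  rewrite !simp => /col_mx_eq0P [/eqP]; rewrite addrC addr_eq0 -(mulmxN E).
  move=> /eqP/esym/AC X Hr; have [|v [Av Cv]] := X.
    by rewrite mulmxN Hr oppr0.
  by exists v; rewrite !simp Av Cv mulmxN.
- by rewrite col_mx0.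
- by rewrite /block_mx [RHS]rk_col_mxC // rk_col_mxA !col_row_mx.
- by rewrite addnC.
Qed.

(** The condition for [G2 (G3 + G4)]: [v3] and [v4] are the values of the two summands. *)
Lemma rk_AA_C_D_H :
  rk [colmx [rowmx 0, 0, E, F, G]; [rowmx 0, 0, H, 0, 0];
            [rowmx A, A, -Phi, 0, 0]; [rowmx C, 0, 0, Psi, 0];
            [rowmx 0, D, 0, 0, Omega]]
    = (rk [colmx [rowmx E, F, G]; [rowmx H, 0, 0]]
       + rk [colmx [rowmx A, A]; [rowmx C, 0]; [rowmx 0, D]])%N <->
  (forall r1 r2 r3, E *m r1 = F *m r2 + G *m r3 -> H *m r1 = 0 ->
     exists v3 v4 : 'cV_p, [/\ A *m v3 + A *m v4 = Phi *m r1,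
       C *m v3 = Psi *m r2 & D *m v4 = Omega *m r3]).
Proof.
rewrite (@rk_rothP _ _ _ _ _ _ _ [colmx [rowmx A, A]; [rowmx C, 0]; [rowmx 0, D]]
  [colmx [rowmx -Phi, 0, 0]; [rowmx 0, Psi, 0]; [rowmx 0, 0, Omega]]
  [colmx [rowmx 0, 0]; [rowmx 0, 0]] [colmx [rowmx E, F, G]; [rowmx H, 0, 0]]) //.
- split=> ACD.
    move=> r1 r2 r3 EFG Hr; have [|v] := ACD (col_mx (- r1) (col_mx r2 r3)).
      by rewrite !simp EFG Hr addNr oppr0 col_mx0.
    rewrite -[v]vsubmxK !simp => /eq_col_mx [? /eq_col_mx [? ?]].
    by exists (usubmx v), (dsubmx v).
  move=> r; rewrite -[r]vsubmxK -[dsubmx r]vsubmxK.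
  move: (usubmx r) (usubmx _) (dsubmx _) => r1 r2 r3 {r}.
  rewrite !simp => /col_mx_eq0P [/eqP]; rewrite addrC addr_eq0 -(mulmxN E).
  move=> /eqP/esym/ACD X Hr; have [|v [w [Av Cv Dw]]] := X.
    by rewrite mulmxN Hr oppr0.
  by exists (col_mx v w); rewrite !simp Av Cv Dw mulmxN.
- by rewrite !row_mx0 col_mx0.
- by rewrite /block_mx [RHS]rk_col_mxC // rk_col_mxA !col_row_mx rk_row_mxA.
- by rewrite addnC.
Qed.

Lemma rk_AB_C_D :
  rk [colmx [rowmx 0, 0, E, F, 0]; [rowmx 0, 0, E, 0, G];
            [rowmx A, B, -Phi, 0, 0]; [rowmx C, 0, 0, Psi, 0];
            [rowmx D, 0, 0, 0, Omega]]
    = (rk [colmx [rowmx A, B]; [rowmx C, 0]; [rowmx D, 0]]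
       + rk [colmx [rowmx E, F, 0]; [rowmx E, 0, G]])%N <->
  (forall r1 r2 r3, E *m r1 = F *m r2 -> E *m r1 = G *m r3 ->
     exists (v : 'cV_p) (w : 'cV_q), [/\ A *m v + B *m w = Phi *m r1,
       C *m v = Psi *m r2 & D *m v = Omega *m r3]).
Proof.
rewrite (@rk_rothP _ _ _ _ _ _ _ [colmx [rowmx A, B]; [rowmx C, 0]; [rowmx D, 0]]
  [colmx [rowmx -Phi, 0, 0]; [rowmx 0, Psi, 0]; [rowmx 0, 0, Omega]]
  [colmx [rowmx 0, 0]; [rowmx 0, 0]] [colmx [rowmx E, F, 0]; [rowmx E, 0, G]]) //.
- split=> ABCD.
    move=> r1 r2 r3 EF EG; have [|v] := ABCD (col_mx (- r1) (col_mx r2 r3)).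
      by rewrite !simp {1}EF EG !addNr col_mx0.
    rewrite -[v]vsubmxK !simp => /eq_col_mx [? /eq_col_mx [? ?]].
    by exists (usubmx v), (dsubmx v).
  move=> r; rewrite -[r]vsubmxK -[dsubmx r]vsubmxK.
  move: (usubmx r) (usubmx _) (dsubmx _) => r1 r2 r3 {r}.
  rewrite !simp => /col_mx_eq0P [/eqP + /eqP].
  rewrite ![E *m _ + _]addrC !addr_eq0 -(mulmxN E).
  move=> /eqP/esym/ABCD X /eqP/esym/X [v [w [Av Cv Dv]]].
  by exists (col_mx v w); rewrite !simp Av Cv Dv mulmxN.
- by rewrite !row_mx0 col_mx0.
- by rewrite /block_mx [RHS]rk_col_mxC // rk_col_mxA !col_row_mx rk_row_mxA.
Qed.

Lemma rk_AAB_C_D :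
  rk [colmx [rowmx 0, 0, 0, E, F, G]; [rowmx A, A, B, -Phi, 0, 0];
            [rowmx C, 0, 0, 0, Psi, 0]; [rowmx 0, D, 0, 0, 0, Omega]]
    = (rk [rowmx E, F, G]
       + rk [colmx [rowmx A, A, B]; [rowmx C, 0, 0]; [rowmx 0, D, 0]])%N <->
  (forall r1 r2 r3, E *m r1 = F *m r2 + G *m r3 ->
     exists (v3 v4 : 'cV_p) (w : 'cV_q),
     [/\ A *m v3 + A *m v4 + B *m w = Phi *m r1,
       C *m v3 = Psi *m r2 & D *m v4 = Omega *m r3]).
Proof.
rewrite (@rk_rothP _ _ _ _ _ _ _
  [colmx (row_mx [rowmx A, A] B); (row_mx [rowmx C, 0] 0); (row_mx [rowmx 0, D] 0)]
  [colmx [rowmx -Phi, 0, 0]; [rowmx 0, Psi, 0]; [rowmx 0, 0, Omega]]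
  (row_mx [rowmx 0, 0] 0) [rowmx E, F, G]) //.
- split=> ACD.
    move=> r1 r2 r3 EFG; have [|v] := ACD (col_mx (- r1) (col_mx r2 r3)).
      by rewrite !simp EFG addNr.
    rewrite -[v]vsubmxK -[usubmx v]vsubmxK !simp => /eq_col_mx [? /eq_col_mx [? ?]].
    by exists (usubmx (usubmx v)), (dsubmx (usubmx v)), (dsubmx v).
  move=> r; rewrite -[r]vsubmxK -[dsubmx r]vsubmxK.
  move: (usubmx r) (usubmx _) (dsubmx _) => r1 r2 r3 {r}.
  rewrite !simp => /eqP; rewrite addrC addr_eq0 -(mulmxN E).
  move=> /eqP/esym/ACD [v [v' [w [Av Cv Dv]]]].
  by exists (col_mx (col_mx v v') w); rewrite !simp Av Cv Dv mulmxN.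
- by rewrite !row_mx0.
- by rewrite /block_mx [RHS]rk_col_mxC // !col_row_mx 2![LHS]rk_row_mxA.
- by rewrite addnC !col_row_mx rk_row_mxA.
Qed.

Lemma rk_A_C_D_H :
  rk [colmx [rowmx 0, E, F, 0]; [rowmx 0, E, 0, G]; [rowmx 0, H, 0, 0];
            [rowmx A, -Phi, 0, 0]; [rowmx C, 0, Psi, 0]; [rowmx D, 0, 0, Omega]]
    = (rk [colmx A; C; D]
       + rk [colmx [rowmx E, F, 0]; [rowmx E, 0, G]; [rowmx H, 0, 0]])%N <->
  (forall r1 r2 r3, E *m r1 = F *m r2 -> E *m r1 = G *m r3 -> H *m r1 = 0 ->
     exists v : 'cV_p, [/\ A *m v = Phi *m r1, C *m v = Psi *m r2
       & D *m v = Omega *m r3]).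
Proof.
rewrite (@rk_rothP _ _ _ _ _ _ _ [colmx A; C; D]
  [colmx [rowmx -Phi, 0, 0]; [rowmx 0, Psi, 0]; [rowmx 0, 0, Omega]]
  (col_mx [colmx 0; 0] 0)
  (col_mx [colmx [rowmx E, F, 0]; [rowmx E, 0, G]] [rowmx H, 0, 0])) //.
- split=> ACD.
    move=> r1 r2 r3 EF EG Hr; have [|v] := ACD (col_mx (- r1) (col_mx r2 r3)).
      by rewrite !simp {1}EF EG Hr !addNr oppr0 !col_mx0.
    by rewrite !simp => /eq_col_mx [? /eq_col_mx [? ?]]; exists v.
  move=> r; rewrite -[r]vsubmxK -[dsubmx r]vsubmxK.
  move: (usubmx r) (usubmx _) (dsubmx _) => r1 r2 r3 {r}.
  rewrite !simp => /col_mx_eq0P [/col_mx_eq0P [/eqP + /eqP]].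
  rewrite ![E *m _ + _]addrC !addr_eq0 -(mulmxN E).
  move=> /eqP/esym/ACD X /eqP/esym/X {}X Hr; have [|v [Av Cv Dv]] := X.
    by rewrite mulmxN Hr oppr0.
  by exists v; rewrite !simp Av Cv Dv mulmxN.
- by rewrite !col_mx0.
- by rewrite /block_mx [RHS]rk_col_mxC // 2![LHS]rk_col_mxA !col_row_mx.
- by rewrite -[in RHS]rk_col_mxA.
Qed.

(* The off-diagonal blocks of the big matrix differ from the two matrices on the
   right by permutations and a change of basis in which [F] and [G] trade
   places. *)
Lemma rk_AB_AA_C_D_H :
  rk [colmx [rowmx 0, 0, 0, 0, 0, 0, H];
            [rowmx 0, 0, 0, G, 0, E, 0];
            [rowmx 0, 0, 0, 0, F, E, E];
            [rowmx 0, C, 0, 0, -Psi, 0, 0];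
            [rowmx 0, 0, D, Omega, 0, 0, 0];
            [rowmx 0, A, A, 0, 0, 0, Phi];
            [rowmx B, 0, A, 0, 0, -Phi, 0]]
    = (rk [colmx [rowmx 0, A, B]; [rowmx A, A, 0]; [rowmx C, 0, 0];
                 [rowmx 0, D, 0]]
       + rk [colmx [rowmx 0, E, F, 0]; [rowmx E, E, 0, G];
                   [rowmx H, 0, 0, 0]])%N <->
  (forall r1 r2 r3 r4, H *m r1 = 0 -> E *m r2 = G *m r4 ->
     E *m r1 = F *m r3 + E *m r2 -> exists (v3 v4 : 'cV_p) (w : 'cV_q),
     [/\ C *m v3 = Psi *m r3, D *m v4 = Omega *m r4,
       A *m v3 + A *m v4 = Phi *m r1 & B *m w + A *m v4 = Phi *m r2]).
Proof.
rewrite (@rk_rothP _ _ _ _ _ _ _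
  [colmx (row_mx [rowmx 0, C] 0); (row_mx [rowmx 0, 0] D);
         (row_mx [rowmx 0, A] A); (row_mx [rowmx B, 0] A)]
  [colmx [rowmx 0, -Psi, 0, 0]; [rowmx Omega, 0, 0, 0];
         [rowmx 0, 0, 0, Phi]; [rowmx 0, 0, -Phi, 0]]
  (col_mx [colmx (row_mx [rowmx 0, 0] 0); (row_mx [rowmx 0, 0] 0)]
          (row_mx [rowmx 0, 0] 0))
  (col_mx [colmx [rowmx 0, 0, 0, H]; [rowmx G, 0, E, 0]] [rowmx 0, F, E, E])) //.
- split=> ACD.
    move=> r1 r2 r3 r4 Hr EG EF.
    (* The order and signs follow the last four block columns, headed by [G], [F], [E] and [H]; the
       first three carry [w], [v3], [v4]. *)
    have [|v] := ACD (col_mx r4 (col_mx (- r3) (col_mx (- r2) r1))).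
      by rewrite !simp Hr EF EG subrr [F *m _ + _]addrC addKr addNr !col_mx0.
    rewrite -[v]vsubmxK -[usubmx v]vsubmxK !simp.
    move=> /eq_col_mx [? /eq_col_mx [? /eq_col_mx [? ?]]].
    by exists (dsubmx (usubmx v)), (dsubmx v), (usubmx (usubmx v)).
  move=> r; rewrite -[r]vsubmxK.
  move: (usubmx r) (dsubmx r) => r4 {}r.
  rewrite -[r]vsubmxK; move: (usubmx r) (dsubmx r) => r3 {}r.
  rewrite -[r]vsubmxK; move: (usubmx r) (dsubmx r) => r2 r1 {r}.
  rewrite !simp => /col_mx_eq0P [/col_mx_eq0P [Hr EG] EF].
  have [|||v3 [v4 [w [Cv Dv Av Bw]]]] := ACD r1 (- r2) (- r3) r4 => //.
  + by rewrite mulmxN; apply/eqP; rewrite eq_sym -addr_eq0 EG.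
  + rewrite !mulmxN -opprD; apply/eqP; rewrite -addr_eq0 addrC.
    by rewrite -addrA EF.
  by exists (col_mx (col_mx w v3) v4); rewrite !simp Cv Dv Av Bw !mulmxN.
- by rewrite !row_mx0 !col_mx0.
- by rewrite /block_mx [RHS]rk_col_mxC // 2![LHS]rk_col_mxA !col_row_mx 2![LHS]rk_row_mxA.
- congr addn.
    apply: (@rk_equiv _ divR _ _ _ _ _ _
      [colmx [rowmx 0, 0, 0, 1%:M]; [rowmx 0, 0, 1%:M, 0];
             [rowmx 1%:M, 0, 0, 0]; [rowmx 0, 1%:M, 0, 0]]
      (col_mx [colmx [rowmx 0, 0, 1%:M]; [rowmx 1%:M, 0, 0]] [rowmx 0, 1%:M, 0])
      [colmx [rowmx 0, 0, 1%:M, 0]; [rowmx 0, 0, 0, 1%:M];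
             [rowmx 0, 1%:M, 0, 0]; [rowmx 1%:M, 0, 0, 0]]
      [colmx (row_mx [rowmx 0, 1%:M] 0); (row_mx [rowmx 0, 0] 1%:M);
             (row_mx [rowmx 1%:M, 0] 0)]);
    by rewrite !block_simp.
  (* With coordinates [x1] to [x4] on the displayed matrix, the two [E] columns receive [-(x1 + x2)]
     and [x1], which moves the double [E] from the row of [F] to that of [G]. *)
  apply: (@rk_equiv _ divR _ _ _ _ _ _
    [colmx (row_mx [rowmx 0, 0] (- 1%:M)); (row_mx [rowmx 0, - 1%:M] 0);
           (row_mx [rowmx 1%:M, 0] 0)]
    [colmx [rowmx 0, 0, 0, - 1%:M]; [rowmx 0, 0, - 1%:M, 0];
           [rowmx - 1%:M, - 1%:M, 0, 0]; [rowmx 1%:M, 0, 0, 0]]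
    (col_mx [colmx [rowmx 0, 0, 1%:M]; [rowmx 0, - 1%:M, 0]]
            [rowmx - 1%:M, 0, 0])
    [colmx [rowmx 0, 0, 0, 1%:M]; [rowmx 0, 0, - 1%:M, - 1%:M];
           [rowmx 0, - 1%:M, 0, 0]; [rowmx - 1%:M, 0, 0, 0]]);
  by rewrite !(block_simp, addNr, addrN).
Qed.

End RankConditions.

(** * The system of matrix equations *)

Lemma mulmx_col_ext (R : unitRingType) m n (A B : 'M[R]_(m, n)) :
  (forall r : 'cV_n, A *m r = B *m r) -> A = B.
Proof.
move=> AB; apply/matrixP=> i j; have /colP/(_ i) := AB (delta_mx j 0).
by rewrite -!colE !mxE.
Qed.

Section Solvability.
Variable R : unitRingType.
Hypothesis divR : forall x : R, x != 0 -> x \is a GRing.unit.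

(** With [B *m V = T], take [Y = V *m H']: since [T] vanishes on the kernel of [H],
    [T *m H' *m H = T]. This recovers [Y] once [X] is known. *)
Lemma mulmx2_solvable m q q1 m1 (B : 'M[R]_(m, q)) (H : 'M[R]_(q1, m1))
    (T : 'M[R]_(m, m1)) :
    (forall r : 'cV_m1, exists w : 'cV_q, B *m w = T *m r) ->
    (forall r : 'cV_m1, H *m r = 0 -> T *m r = 0) ->
  exists Y, B *m Y *m H = T.
Proof.
move=> /solvable_columns [V BV] TH.
have [H' HH] := generalized_inverse divR H.
exists (V *m H'); rewrite mulmxA BV; apply: mulmx_col_ext => r.
apply/eqP; rewrite -subr_eq0 -!mulmxA -mulmxBr; apply/eqP/TH.
by rewrite mulmxBr !mulmxA HH subrr.
Qed.

Variables (m p q p1 q1 m1 : nat).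
Variables (A : 'M[R]_(m, p)) (B : 'M[R]_(m, q)) (E : 'M[R]_(p1, m1))
  (H : 'M[R]_(q1, m1)) (Phi : 'M[R]_(m, m1)).

(* Under the solvability of [C *m v = Psi *m r] for all [r], a matrix [X]
   satisfies [C *m X *m F = Psi] when [interpolation C F Psi u (X *m u)] holds
   for all [u] in the column space of [F]. *)
Definition interpolation s s1 (C : 'M[R]_(s, p)) (F : 'M[R]_(p1, s1))
  (Psi : 'M[R]_(s, s1)) : relation R p1 p :=
  fun u v => exists r, u = F *m r /\ C *m v = Psi *m r.

(* The constraints on [X] modulo the column space of [B], and on the image
   under [E] of the kernel of [H], where [B *m Y *m H] disappears. *)
Definition interpolation_mod : relation R p1 p :=
  fun u v => exists r w, u = E *m r /\ A *m v + B *m w = Phi *m r.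

Definition interpolation_ker : relation R p1 p :=
  fun u v => exists r, [/\ u = E *m r, H *m r = 0 & A *m v = Phi *m r].

Lemma linear_interpolation s s1 C F Psi :
  linear_rel (@interpolation s s1 C F Psi).
Proof.
split=> [|_ v _ v' a [r [-> Cv]] [r' [-> Cv']]].
  by exists 0; rewrite !mulmx0.
by exists (r + r' *m a); rewrite !mulmxDr !mulmxA Cv Cv'.
Qed.

Lemma linear_interpolation_mod : linear_rel interpolation_mod.
Proof.
split=> [|_ v _ v' a [r [w [-> Av]]] [r' [w' [-> Av']]]].
  by exists 0, 0; rewrite !mulmx0 addr0.
exists (r + r' *m a), (w + w' *m a).
by rewrite !mulmxDr !mulmxA addrACA Av -!mulmxDl Av'.
Qed.

Lemma linear_interpolation_ker : linear_rel interpolation_ker.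
Proof.
split=> [|_ v _ v' a [r [-> Hr Av]] [r' [-> Hr' Av']]].
  by exists 0; rewrite !mulmx0.
exists (r + r' *m a).
by rewrite !mulmxDr !mulmxA Hr Hr' Av Av' mul0mx addr0.
Qed.

End Solvability.

Theorem theorem3p1 (R : unitRingType)
  (divR : forall x : R, x != 0 -> x \is a GRing.unit)
  (m p q s t p1 q1 m1 s1 t1 : nat)
  (A : 'M[R]_(m, p)) (B : 'M[R]_(m, q)) (C : 'M[R]_(s, p)) (D : 'M[R]_(t, p))
  (E : 'M[R]_(p1, m1)) (F : 'M[R]_(p1, s1)) (G : 'M[R]_(p1, t1))
  (H : 'M[R]_(q1, m1))
  (Phi : 'M[R]_(m, m1)) (Psi : 'M[R]_(s, s1)) (Omega : 'M[R]_(t, t1)) :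
  (exists (X : 'M[R]_(p, p1)) (Y : 'M[R]_(q, q1)),
     [/\ A *m X *m E + B *m Y *m H = Phi,
         C *m X *m F = Psi
       & D *m X *m G = Omega])
  <->
  (  rk [colmx [rowmx Phi, A]; [rowmx H, 0]] = (rk A + rk H)%N /\
     rk [colmx [rowmx Phi, B]; [rowmx E, 0]] = (rk B + rk E)%N /\
     rk [rowmx A, B, Phi] = rk [rowmx A, B] /\
     rk [colmx E; H; Phi] = rk [colmx E; H] /\
     rk [rowmx C, Psi] = rk C /\
     rk [rowmx D, Omega] = rk D /\
     rk [colmx F; Psi] = rk F /\
     rk [colmx G; Omega] = rk G /\
     rk [colmx [rowmx Psi, 0, C]; [rowmx 0, -Omega, D]; [rowmx F, G, 0]]
      = (rk [colmx C; D] + rk [rowmx F, G])%N /\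
     rk [colmx [rowmx 0, 0, E, F];
               [rowmx A, B, -Phi, 0];
               [rowmx C, 0, 0, Psi]]
      = (rk [colmx [rowmx A, B]; [rowmx C, 0]] + rk [rowmx E, F])%N /\
     rk [colmx [rowmx 0, E, F];
               [rowmx 0, H, 0];
               [rowmx A, -Phi, 0];
               [rowmx C, 0, Psi]]
      = (rk [colmx [rowmx E, F]; [rowmx H, 0]] + rk [colmx A; C])%N /\
     rk [colmx [rowmx 0, 0, E, G];
               [rowmx A, B, -Phi, 0];
               [rowmx D, 0, 0, Omega]]
      = (rk [colmx [rowmx A, B]; [rowmx D, 0]] + rk [rowmx E, G])%N /\
     rk [colmx [rowmx 0, E, G];
               [rowmx 0, H, 0];
               [rowmx A, -Phi, 0];
               [rowmx D, 0, Omega]]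
      = (rk [colmx [rowmx E, G]; [rowmx H, 0]] + rk [colmx A; D])%N /\
     rk [colmx [rowmx 0, 0, E, F, G];
               [rowmx 0, 0, H, 0, 0];
               [rowmx A, A, -Phi, 0, 0];
               [rowmx C, 0, 0, Psi, 0];
               [rowmx 0, D, 0, 0, Omega]]
      = (rk [colmx [rowmx E, F, G]; [rowmx H, 0, 0]]
       + rk [colmx [rowmx A, A]; [rowmx C, 0]; [rowmx 0, D]])%N /\
     rk [colmx [rowmx 0, 0, E, F, 0];
               [rowmx 0, 0, E, 0, G];
               [rowmx A, B, -Phi, 0, 0];
               [rowmx C, 0, 0, Psi, 0];
               [rowmx D, 0, 0, 0, Omega]]
      = (rk [colmx [rowmx A, B]; [rowmx C, 0]; [rowmx D, 0]]
       + rk [colmx [rowmx E, F, 0]; [rowmx E, 0, G]])%N /\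
     rk [colmx [rowmx 0, 0, 0, E, F, G];
               [rowmx A, A, B, -Phi, 0, 0];
               [rowmx C, 0, 0, 0, Psi, 0];
               [rowmx 0, D, 0, 0, 0, Omega]]
      = (rk [rowmx E, F, G]
       + rk [colmx [rowmx A, A, B]; [rowmx C, 0, 0]; [rowmx 0, D, 0]])%N /\
     rk [colmx [rowmx 0, E, F, 0];
               [rowmx 0, E, 0, G];
               [rowmx 0, H, 0, 0];
               [rowmx A, -Phi, 0, 0];
               [rowmx C, 0, Psi, 0];
               [rowmx D, 0, 0, Omega]]
      = (rk [colmx A; C; D]
       + rk [colmx [rowmx E, F, 0]; [rowmx E, 0, G]; [rowmx H, 0, 0]])%N /\
     rk [colmx [rowmx 0, 0, 0, 0, 0, 0, H];
               [rowmx 0, 0, 0, G, 0, E, 0];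
               [rowmx 0, 0, 0, 0, F, E, E];
               [rowmx 0, C, 0, 0, -Psi, 0, 0];
               [rowmx 0, 0, D, Omega, 0, 0, 0];
               [rowmx 0, A, A, 0, 0, 0, Phi];
               [rowmx B, 0, A, 0, 0, -Phi, 0]]
      = (rk [colmx [rowmx 0, A, B];
                   [rowmx A, A, 0];
                   [rowmx C, 0, 0];
                   [rowmx 0, D, 0]]
       + rk [colmx [rowmx 0, E, F, 0];
                   [rowmx E, E, 0, G];
                   [rowmx H, 0, 0, 0]])%N).
Proof.
split=> [[X [Y [<- <- <-]]]|].
  (* Necessity: a solution supplies every required vector as [X] or [Y] applied to the data. *)
  have PhiE r : (A *m X *m E + B *m Y *m H) *m r =
      A *m (X *m (E *m r)) + B *m (Y *m (H *m r)) by rewrite mulmxDl !mulmxA.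
  have Phi0 r : H *m r = 0 ->
      (A *m X *m E + B *m Y *m H) *m r = A *m (X *m (E *m r)).
    by move=> Hr; rewrite PhiE Hr !mulmx0 addr0.
  split; first apply/(rk_Phi_A_H divR) => r Hr.
    by exists (X *m (E *m r)); rewrite Phi0.
  split; first apply/(rk_Phi_A_H divR) => r Er.
    by exists (Y *m (H *m r)); rewrite PhiE Er !mulmx0 add0r.
  split; first apply/(rk_A_B_Phi divR) => r.
    by exists (X *m (E *m r)), (Y *m (H *m r)); rewrite PhiE.
  split; first apply/(rk_E_H_Phi divR) => r Er Hr.
    by rewrite PhiE Er Hr !mulmx0 addr0.
  split; first apply/(rk_row_mx divR) => r.
    by exists (X *m (F *m r)); rewrite !mulmxA.
  split; first apply/(rk_row_mx divR) => r.
    by exists (X *m (G *m r)); rewrite !mulmxA.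
  split; first apply/(rk_col_mx divR) => r Fr.
    by rewrite -!mulmxA Fr !mulmx0.
  split; first apply/(rk_col_mx divR) => r Gr.
    by rewrite -!mulmxA Gr !mulmx0.
  split; first apply/(rk_C_D divR) => r2 r3 FG.
    by exists (X *m (F *m r2)); rewrite {2}FG !mulmxA.
  split; first apply/(rk_AB_C divR) => r1 r2 EF.
    exists (X *m (E *m r1)), (Y *m (H *m r1)).
    by split; [rewrite PhiE|rewrite EF !mulmxA].
  split; first apply/(rk_A_C_H divR) => r1 r2 EF Hr.
    by exists (X *m (E *m r1)); split; [rewrite Phi0|rewrite EF !mulmxA].
  split; first apply/(rk_AB_C divR) => r1 r2 EF.
    exists (X *m (E *m r1)), (Y *m (H *m r1)).
    by split; [rewrite PhiE|rewrite EF !mulmxA].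
  split; first apply/(rk_A_C_H divR) => r1 r2 EF Hr.
    by exists (X *m (E *m r1)); split; [rewrite Phi0|rewrite EF !mulmxA].
  split; first apply/(rk_AA_C_D_H divR) => r1 r2 r3 EFG Hr.
    exists (X *m (F *m r2)), (X *m (G *m r3)).
    by rewrite Phi0 // EFG !mulmxDr !mulmxA.
  split; first apply/(rk_AB_C_D divR) => r1 r2 r3 EF EG.
    exists (X *m (E *m r1)), (Y *m (H *m r1)).
    by split; [rewrite PhiE|rewrite EF !mulmxA|rewrite EG !mulmxA].
  split; first apply/(rk_AAB_C_D divR) => r1 r2 r3 EFG.
    exists (X *m (F *m r2)), (X *m (G *m r3)), (Y *m (H *m r1)).
    by rewrite PhiE EFG !mulmxDr !mulmxA.
  split; first apply/(rk_A_C_D_H divR) => r1 r2 r3 EF EG Hr.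
    exists (X *m (E *m r1)).
    by split; [rewrite Phi0|rewrite EF !mulmxA|rewrite EG !mulmxA].
  apply/(rk_AB_AA_C_D_H divR) => r1 r2 r3 r4 Hr EG EF.
  exists (X *m (F *m r3)), (X *m (G *m r4)), (Y *m (H *m r2)).
  by rewrite Phi0 // PhiE EF EG !mulmxDr !mulmxA [B *m _ *m _ *m _ + _]addrC.
(* Sufficiency. Digits in the names of the conditions refer to the relations [G1] to [G4]. *)
case=> /(rk_Phi_A_H divR) cA [/(rk_Phi_A_H divR) cB].
case=> /(rk_A_B_Phi divR) cAB [/(rk_E_H_Phi divR) cEH].
case=> /(rk_row_mx divR) cC [/(rk_row_mx divR) cD].
case=> /(rk_col_mx divR) cF [/(rk_col_mx divR) cG].
case=> /(rk_C_D divR) c34.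
case=> /(rk_AB_C divR) c13 [/(rk_A_C_H divR) c23].
case=> /(rk_AB_C divR) c14 [/(rk_A_C_H divR) c24].
case=> /(rk_AA_C_D_H divR) c2_34 [/(rk_AB_C_D divR) c134].
case=> /(rk_AAB_C_D divR) c1_34 [/(rk_A_C_D_H divR) c234].
move/(rk_AB_AA_C_D_H divR) => c2_1314.
have [] := @common_selection _ divR _ _ (interpolation_mod A B E Phi)
  (interpolation_ker A E H Phi) (interpolation C F Psi) (interpolation D G Omega)
  (linear_interpolation_mod _ _ _ _) (linear_interpolation_ker _ _ _ _)
  (linear_interpolation _ _ _) (linear_interpolation _ _ _).
- by move=> u v [r [-> Hr Av]]; exists r, 0; rewrite mulmx0 addr0.
- move=> u [_ [r2 [uF _]]] [_ [r3 [uG _]]].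
  have [v [Cv Dv]] := c34 r2 r3 (etrans (esym uF) uG).
  by exists v; split; [exists r2|exists r3].
- move=> u [_ [r1 [_ [uE _]]]] [_ [r2 [uF _]]].
  have [v [w [Av Cv]]] := c13 r1 r2 (etrans (esym uE) uF).
  by exists v; split; [exists r1, w|exists r2].
- move=> u [_ [r1 [uE Hr _]]] [_ [r2 [uF _]]].
  have [v [Av Cv]] := c23 r1 r2 (etrans (esym uE) uF) Hr.
  by exists v; split; [exists r1|exists r2].
- move=> u [_ [r1 [_ [uE _]]]] [_ [r2 [uG _]]].
  have [v [w [Av Dv]]] := c14 r1 r2 (etrans (esym uE) uG).
  by exists v; split; [exists r1, w|exists r2].
- move=> u [_ [r1 [uE Hr _]]] [_ [r2 [uG _]]].
  have [v [Av Dv]] := c24 r1 r2 (etrans (esym uE) uG) Hr.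
  by exists v; split; [exists r1|exists r2].
- move=> u [_ [r1 [uE Hr _]]] [_ [_ [_ [_ [_ [[r2 [-> _]] [r3 [-> _]] uFG _]]]]]].
  have [v3 [v4 [Av Cv Dv]]] := c2_34 r1 r2 r3 (etrans (esym uE) uFG) Hr.
  exists (v3 + v4); split; first by exists r1; rewrite mulmxDr.
  by exists (F *m r2), v3, (G *m r3), v4; split=> //; [exists r2|exists r3].
- move=> u [_ [r1 [_ [uE _]]]] [_ [_ [_ [_ [_ [[r2 [-> _]] [r3 [-> _]] uFG _]]]]]].
  have [v3 [v4 [w [Av Cv Dv]]]] := c1_34 r1 r2 r3 (etrans (esym uE) uFG).
  exists (v3 + v4); split; first by exists r1, w; rewrite mulmxDr.
  by exists (F *m r2), v3, (G *m r3), v4; split=> //; [exists r2|exists r3].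
- move=> u [_ [[r1 [_ [uE _]]] [r2 [uF _]]]] [_ [_ [r3 [uG _]]]].
  have [v [w [Av Cv Dv]]] :=
    c134 r1 r2 r3 (etrans (esym uE) uF) (etrans (esym uE) uG).
  have G1uv : interpolation_mod A B E Phi u v by exists r1, w.
  by exists v; split; split=> //; [exists r2|exists r3].
- move=> u [_ [[r1 [uE Hr _]] [r2 [uF _]]]] [_ [_ [r3 [uG _]]]].
  have [v [Av Cv Dv]] :=
    c234 r1 r2 r3 (etrans (esym uE) uF) (etrans (esym uE) uG) Hr.
  have G2uv : interpolation_ker A E H Phi u v by exists r1.
  by exists v; split; split=> //; [exists r2|exists r3].
- move=> u [_ [r1 [uE Hr _]]] [_ [u3 [x3 [u4 [x4 [G13 G14 uD _]]]]]].
  case: G13 G14 => _ [r3 [u3F _]] [[r2 [_ [u4E _]]] [r4 [u4G _]]].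
  have [||v3 [v4 [w [Cv Dv Av Bw]]]] := c2_1314 r1 r2 r3 r4 Hr.
  + by rewrite -u4E.
  + by rewrite -uE uD u3F u4E.
  exists (v3 + v4); split; first by exists r1; rewrite mulmxDr.
  exists u3, v3, u4, v4; split=> //; split.
  (* Here [u3 = u - u4], and subtracting the equations for [r1] and [r2] cancels [A *m v4]. *)
  + exists (r1 - r2), (- w); rewrite !mulmxBr -uE -u4E uD addrK; split=> //.
    by rewrite -Av -Bw mulmxN opprD addrACA subrr addr0.
  + by exists r3.
  + by exists r2, w; rewrite addrC.
  + by exists r4.
move=> X XP; exists X.
have [Y BYH] : exists Y, B *m Y *m H = Phi - A *m X *m E.
  apply: (mulmx2_solvable divR) => r.
    (* The relation yields some [r'] with [E *m r' = E *m r], perhaps not [r] itself; [cB] puts the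
       discrepancy in the column space of [B]. *)
    have [v [w Avw]] := cAB r; have [G1 _ _ _] := XP (E *m r).
    have [|r' [w' [Er Xr]]] := G1; first by exists v, r, w.
    have [|w2 Bw2] := cB (r - r'); first by rewrite mulmxBr Er subrr.
    exists (w' + w2); rewrite mulmxDr Bw2 !mulmxBr mulmxBl -!mulmxA -Xr.
    by rewrite opprD addrCA [B *m w' + _]addrCA subrr addr0.
  move=> Hr; have [v Av] := cA r Hr; have [_ G2 _ _] := XP (E *m r).
  have [|r' [Er Hr' Xr]] := G2; first by exists v, r.
  rewrite mulmxBl -!mulmxA Xr -mulmxBr; apply: cEH.
    by rewrite mulmxBr Er subrr.
  by rewrite mulmxBr Hr Hr' subrr.
exists Y; split; first by rewrite BYH addrC subrK.
  (* Likewise [r] and [r'] may differ by a kernel vector of [F], on which [cF] makes [Psi]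
     vanish. *)
  apply: mulmx_col_ext => r; have [v Cv] := cC r; have [_ _ G3 _] := XP (F *m r).
  have [|r' [Fr Xr]] := G3; first by exists v, r.
  rewrite -!mulmxA Xr; apply/esym/eqP; rewrite -subr_eq0 -mulmxBr.
  by apply/eqP/cF; rewrite mulmxBr Fr subrr.
apply: mulmx_col_ext => r; have [v Dv] := cD r; have [_ _ _ G4] := XP (G *m r).
have [|r' [Gr Xr]] := G4; first by exists v, r.
rewrite -!mulmxA Xr; apply/esym/eqP; rewrite -subr_eq0 -mulmxBr.
by apply/eqP/cG; rewrite mulmxBr Gr subrr.
Qed.
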